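(* Let $V$ be a finite-dimensional real vector space and let $\gamma,\beta\in GL(V)$ satisfy $\gamma\neq\beta$, $\gamma\neq\mathrm{id}$, $\beta\neq\mathrm{id}$ and $\gamma^2=\mathrm{id}=\beta^2$. Let $(M_\gamma,R_\gamma)$ and $(M_\beta,R_\beta)$ be the associated Hom-Lie groups, with Hom-Lie algebras $(\mathfrak{gl}(V),[\cdot,\cdot]_\gamma,\mathrm{Ad}_\gamma)$ and $(\mathfrak{gl}(V),[\cdot,\cdot]_\beta,\mathrm{Ad}_\beta)$, respectively. Suppose that $\Phi:(M_\gamma,R_\gamma)\to(M_\beta,R_\beta)$ is a Hom-Lie group homomorphism. Then there exists a real linear map $\phi:\mathfrak{gl}(V)\to\mathfrak{gl}(V)$, regarded as a map from $(\mathfrak{gl}(V),[\cdot,\cdot]_\gamma,\mathrm{Ad}_\gamma)$ to $(\mathfrak{gl}(V),[\cdot,\cdot]_\beta,\mathrm{Ad}_\beta)$, such that $$\Phi(e^{\gamma X})=e^{\beta\phi(X)}\quad\text{for all }X\in\mathfrak{gl}(V).$$ The map $\phi$ has the following additional properties: (1) $\phi\circ\mathrm{Ad}_\gamma(X)=\mathrm{Ad}_\beta\circ\phi(X)$ for all $X\in\mathfrak{gl}(V)$; (2) $\phi(e^{\gamma X}\gamma Ye^{-\gamma X}\gamma)=\Phi(e^{\gamma X}\gamma)\,\phi(Y)\,\Phi(e^{-\gamma X}\gamma)$ for all $X,Y\in\mathfrak{gl}(V)$; (3) $\phi([X,Y]_\gamma)=[\phi(X),\phi(Y)]_\beta$ for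 all $X,Y\in\mathfrak{gl}(V)$; (4) $\beta\phi(X)=\frac{d}{dt}\Phi(e^{t\gamma X})\big|_{t=0}$ for all $X\in\mathfrak{gl}(V)$.
   Context: For $\beta\in GL(V)$ and $A,B\in\mathfrak{gl}(V)$ put $[A,B]_\beta=\beta A\beta^{-1}B\beta^{-1}-\beta B\beta^{-1}A\beta^{-1}$ and $\mathrm{Ad}_\beta(A)=\beta A\beta^{-1}$; $(\mathfrak{gl}(V),[\cdot,\cdot]_\beta,\mathrm{Ad}_\beta)$ is a Hom-Lie algebra, i.e. the bracket is skew-symmetric bilinear, $\mathrm{Ad}_\beta$ preserves it, and $[\mathrm{Ad}_\beta(x),[y,z]_\beta]_\beta+[\mathrm{Ad}_\beta(y),[z,x]_\beta]_\beta+[\mathrm{Ad}_\beta(z),[x,y]_\beta]_\beta=0$. Hom-Lie group: let $G$ be a Lie group and $S$ a submanifold of $G$. If there is a diffeomorphism $F:G\to G$ such that $F(S)$ is a subgroup of $G$, then $(S,F)$ is called a Hom-Lie group. For $\beta\in GL(V)$ with $\beta^2=\mathrm{id}$: $M_\beta=\{e^{\beta X}\beta\mid X\in\mathfrak{gl}(V)\}\subset GL(V)$ and $R_\beta:GL(V)\to GL(V)$, $R_\beta(A)=A\beta$. The paper states that $(M_\beta,R_\beta)$ is a Hom-Lie group (with $G=GL(V)$). Hom-Lie group homomorphism: let $G_1,G_2$ be Lie groups, $S_i$ a submanifold of $G_i$, and $(S_1,F_1)$, $(S_2,F_2)$ Hom-Lie groups. A Lie group homomorphism $\Phi:G_1\to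 G_2$ is called a Hom-Lie group homomorphism from $(S_1,F_1)$ to $(S_2,F_2)$ if (i) $\Phi(S_1)\subset S_2$, and (ii) $F_2\circ\Phi(xy)=\Phi\circ F_1(xy)$ for all $x,y\in S_1$. In particular, in the claim $\Phi$ is a Lie group homomorphism $GL(V)\to GL(V)$. *)

(* Defs.v *)
From HB Require Import structures.
From mathcomp Require Import all_boot all_order all_algebra.
From mathcomp Require Import all_classical all_reals all_analysis.

Set Implicit Arguments.
Unset Strict Implicit.
Unset Printing Implicit Defensive.

Import Order.TTheory GRing.Theory Num.Theory.
Import numFieldNormedType.Exports.

Local Open Scope classical_set_scope.
Local Open Scope ring_scope.

(* The topology of the finite-dimensional space 'Hom(V, W) is the one induced
   by the sup norm of the matrix of a map; since all norms on a
   finite-dimensional real vector space are equivalent, the notions of limit,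
   continuity and derivative do not depend on this choice. *)
Section LfunNorm.
Variables (R : realType) (V W : vectType R).
Implicit Types A B : 'Hom(V, W).

Definition lfun_norm A : R :=
  `|passmx.mxof (vbasis {:V}) (vbasis {:W}) A|.

Let lfun_normD A B : lfun_norm (A + B) <= lfun_norm A + lfun_norm B.
Proof.
rewrite /lfun_norm -{1}[A]scale1r passmx.mxof_linear scale1r.
exact: ler_normD.
Qed.

Let lfun_normZ (k : R) A : lfun_norm (k *: A) = `|k| * lfun_norm A.
Proof.
rewrite /lfun_norm -normrZ -{1}[k *: A]addr0 passmx.mxof_linear.
suff -> : passmx.mxof (vbasis {:V}) (vbasis {:W}) 0 = 0 by rewrite addr0.
have := passmx.mxof_linear (vbasis {:V}) (vbasis {:W}) (-1) A A.
by rewrite !scaleN1r !addNr.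
Qed.

Let lfun_norm0_eq0 A : lfun_norm A = 0 -> A = 0.
Proof.
move=> /normr0_eq0 A0.
rewrite -(passmx.mxofK (vbasisP {:V}) (vbasisP {:W}) A) A0; apply/lfunP => u.
by rewrite (passmx.hommxE (vbasisP _) (vbasisP _)) mulmx0 lfunE /= /passmx.vecof
  big1 // => i _; rewrite mxE scale0r.
Qed.

HB.instance Definition _ := Lmodule_isNormed.Build R 'Hom(V, W)
  lfun_normD lfun_normZ lfun_norm0_eq0.

End LfunNorm.

Section Smooth.
Variables (R : realType) (E F : normedModType R).

(* [f] is C^k on [U]: all iterated directional derivatives of order at most
   [k] exist and are continuous at every point of [U]. It is meant for [U]
   open, in which case only the values of [f] on [U] matter. *)
Fixpoint Ck_on (k : nat) (U : set E) (f : E -> F) : Prop :=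
  (forall x, U x -> {for x, continuous f}) /\
  if k is k'.+1 then
    forall v : E, (forall x, U x -> derivable f x v) /\ Ck_on k' U ('D_v f)
  else True.

Definition smooth_on (U : set E) (f : E -> F) : Prop :=
  forall k : nat, Ck_on k U f.

End Smooth.

Section GeneralLinear.
Variables (R : realType) (V : vectType R).
Implicit Types A B X beta : 'End(V).

Definition GL : set 'End(V) := [set A | lker A == 0%VS].

Definition lfun_pow A (k : nat) : 'End(V) := iter k (comp_lfun A) \1%VF.

Definition lfun_exp A : 'End(V) :=
  limn (series (fun k : nat => k`!%:R^-1 *: lfun_pow A k)).

(* [beta^-1] is the two-sided inverse of [beta] when [beta] is in [GL]. *)
Definition hom_bracket beta A B : 'End(V) :=
  (beta \o A \o beta^-1 \o B \o beta^-1)%VF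
  - (beta \o B \o beta^-1 \o A \o beta^-1)%VF.

Definition Ad beta A : 'End(V) := (beta \o A \o beta^-1)%VF.

Definition M_ beta : set 'End(V) :=
  [set (lfun_exp (beta \o X)%VF \o beta)%VF | X in [set: 'End(V)]].

Definition R_ beta A : 'End(V) := (A \o beta)%VF.

End GeneralLinear.
Arguments GL {R} V.

(* Maps between general linear groups are represented by total functions on
   the ambient spaces of endomorphisms, constrained only on the open set [GL]. *)
Section Morphisms.
Variables (R : realType) (V1 V2 : vectType R).
Implicit Types Phi : 'End(V1) -> 'End(V2).

Definition lie_group_hom Phi : Prop :=
  [/\ forall A, GL V1 A -> GL V2 (Phi A),
      forall A B, GL V1 A -> GL V1 B ->
        Phi (A \o B)%VF = (Phi A \o Phi B)%VF
    & smooth_on (GL V1) Phi].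

(* The pairs are not required to be Hom-Lie groups: the set
   R_beta (M_beta) = exp (gl(V)) is not closed under products as soon as
   dim V >= 2, so such a requirement could not be met by (M_beta, R_beta). *)
Definition hom_lie_group_hom
    (S1 : set 'End(V1)) (F1 : 'End(V1) -> 'End(V1))
    (S2 : set 'End(V2)) (F2 : 'End(V2) -> 'End(V2)) Phi : Prop :=
  [/\ lie_group_hom Phi,
      forall x, S1 x -> S2 (Phi x)
    & forall x y, S1 x -> S1 y ->
        F2 (Phi (x \o y)%VF) = Phi (F1 (x \o y)%VF)].

End Morphisms.

(* Main.v *)
Require Import Defs.
From HB Require Import structures.
From mathcomp Require Import all_boot all_order all_algebra.
From mathcomp Require Import all_classical all_reals all_analysis.
From mathcomp Require Import ring lra.

Set Implicit Arguments.
Unset Strict Implicit.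
Unset Printing Implicit Defensive.

Import Order.TTheory GRing.Theory Num.Theory.
Import numFieldNormedType.Exports passmx.

Local Open Scope classical_set_scope.
Local Open Scope ring_scope.

(** The compatibility of [Phi] with [R_ gamma] and [R_ beta], read at
[x = y = gamma] (the element of [M_ gamma] with [X = 0]), gives
[Phi gamma = beta]. Let
[D A] be the derivative of [Phi] at the identity in the direction [A], and put
[phi X = beta \o D (gamma \o X)]. Since [beta] is an involution,
[beta \o phi X = D (gamma \o X)], and everything reduces to three facts about
a homomorphism [Phi] between general linear groups: [D] is linear,
[Phi (exp A) = exp (D A)], and [D] turns conjugation by [P] into conjugation by
[Phi P] (hence preserves commutators). Property (1) and the rule
[phi (Z \o gamma) = D Z \o beta] are the conjugation rule at [P = gamma];
property (2) is the conjugation rule at [P = exp (gamma \o X)]; property (3) is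
the preservation of commutators, because
[hom_bracket gamma X Y] is the commutator of [gamma \o X] and [gamma \o Y]
composed with [gamma]; and (4) is the derivative at 0 of [exp (t *: D A)].

The first two facts are obtained without any differential calculus beyond
one-variable limits at 0. Say that a curve [c] with values in endomorphisms is
[tangent] to [A] when [(c h - 1) / h] tends to [A] as [h] tends to 0. Then
[c (1/n) ^ n] tends to [exp A] ([tangent_euler]), which follows from the
binomial formula and dominated convergence for series ([tannery]). If [c] is
tangent to [A] and [Phi \o c] is tangent to [B], then applying [Phi] to
[c (1/n) ^ n] and using its continuity at [exp A] yields [Phi (exp A) = exp B]
([lie_hom_exp_tangent]). With [c h = 1 + h A] this is [Phi (exp A) = exp (D A)].
As the rescaled curves [c (t h)] give [exp (t (D A)) = exp (t B)] for all [t],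
differentiating at [t = 0] shows [D A = B] for every such curve [c] and not
only for the straight one ([lie_diff_tangent]). The curve
[(1 + h A) \o (1 + h B)], tangent to [A + B], then gives the additivity of
[D]. *)

(** * Dominated convergence for series *)

Section Tannery.
Variables (R : realType) (E : completeNormedModType R).

Lemma norm_series_sub (u : nat -> E) (g : nat -> R) (m n : nat) :
  (m <= n)%N -> (forall k, `|u k| <= g k) ->
  `|series u n - series u m| <= series g n - series g m.
Proof.
move=> mn ug; rewrite !sub_series_geq//.
by apply: le_trans (ler_norm_sum _ _ _) _; apply: ler_sum.
Qed.

(** Tannery's theorem, i.e. dominated convergence for the counting measure:
beyond a fixed rank [K] both the partial sums and the limit series are
controlled by the tail of the dominating series [g], and below [K] only
finitely many terms have to converge. Allowing the number [m n] of terms to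
depend on [n] is what a binomial expansion requires. *)
Lemma tannery (f : nat -> nat -> E) (h : nat -> E) (g : nat -> R)
    (m : nat -> nat) :
  (forall n, n <= m n)%N -> cvgn (series g) ->
  (\forall n \near \oo, forall k, `|f n k| <= g k) ->
  (forall k, f n k @[n --> \oo] --> h k) ->
  cvgn (series h) /\ series (f n) (m n) @[n --> \oo] --> limn (series h).
Proof.
move=> mge cg fg fh.
have hg k : `|h k| <= g k.
  have fk : `|f n k| @[n --> \oo] --> `|h k| by apply: cvg_norm; exact: fh.
  rewrite -(cvg_lim (@norm_hausdorff _ _) fk); apply: limr_le.
    by apply/cvg_ex; exists `|h k|.
  by near=> n; near: n; apply: filterS fg => n; exact.
have g0 k : 0 <= g k by apply: le_trans (hg k).
have gnd : nondecreasing_seq (series g) by exact: nondecreasing_series.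
have gle n : series g n <= limn (series g) by exact: nondecreasing_cvgn_le.
have ch : cvgn (series h).
  by apply: normed_cvg; apply: series_le_cvg cg => // n; exact: normr_ge0.
split=> //; apply/cvgrPdist_le => e e0.
have e3 : 0 < e / 3 by rewrite divr_gt0.
(* The rank beyond which the tails of [h] and [g] are negligible. *)
have [K [hK gK]] : exists K, `|limn (series h) - series h K| <= e / 3 /\
    limn (series g) - series g K <= e / 3.
  near \oo => K; exists K; split.
    near: K; have /cvgrPdist_le := ch; exact.
  apply: le_trans (ler_norm _) _.
  near: K; have /cvgrPdist_le := cg; exact.
have fhK : series (f n) K @[n --> \oo] --> series h K.
  elim: (K) => [|k IHk].
    rewrite /series /= big_geq//; under eq_fun do rewrite big_geq//.
    exact: cvg_cst.
  rewrite seriesSr; under eq_fun do rewrite seriesSr.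
  exact: cvgD.
have /cvgrPdist_le/(_ _ e3) fhK3 := fhK.
near=> n.
have Kn : (K <= m n)%N.
  by apply: leq_trans (mge n); near: n; exact: nbhs_infty_ge.
have fgn : forall k, `|f n k| <= g k by near: n.
rewrite -(subrKA (series h K)) (le_trans (ler_normD _ _))//.
rewrite [e](_ : _ = e / 3 + (e / 3 + e / 3)); last by lra.
rewrite lerD// -(subrKA (series (f n) K)) (le_trans (ler_normD _ _))// lerD//.
  by near: n.
rewrite distrC (le_trans (norm_series_sub Kn fgn))// (le_trans _ gK)//.
by rewrite lerD2r.
Unshelve. all: by end_near. Qed.

End Tannery.

(** * Binomial coefficients against inverse factorials *)

Section BinomialCoefficients.
Variable R : realType.

Lemma ffact_le_expn (n k : nat) : (n ^_ k <= n ^ k)%N.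
Proof.
by elim: k => // k IH; rewrite ffactnSr expnSr leq_mul// leq_subr.
Qed.

Lemma bin_expn_le (n k : nat) :
  'C(n.+1, k)%:R / n.+1%:R ^+ k <= k`!%:R^-1 :> R.
Proof.
rewrite ler_pdivrMr ?exprn_gt0 ?ltr0n// ler_pdivlMl ?ltr0n ?fact_gt0//.
by rewrite -natrX -natrM ler_nat mulnC bin_ffact ffact_le_expn.
Qed.

(** Consecutive coefficients have the ratio [(n.+1 - k) / n.+1 / k.+1], which
tends to [1 / k.+1], so that the limit is found by induction on [k]. *)
Lemma cvg_bin_expn (k : nat) :
  'C(n.+1, k)%:R / n.+1%:R ^+ k @[n --> \oo] --> (k`!%:R^-1 : R).
Proof.
elim: k => [|k IH].
  under eq_fun do rewrite bin0 expr0 divr1.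
  by rewrite fact0 invr1; exact: cvg_cst.
have -> : (fun n : nat => 'C(n.+1, k.+1)%:R / n.+1%:R ^+ k.+1 : R) =
    (fun n => ('C(n.+1, k)%:R / n.+1%:R ^+ k)
       * ((n.+1 - k)%:R / n.+1%:R * k.+1%:R^-1)).
  apply/funext => n; have := congr1 (fun i => i%:R : R) (mul_bin_left n.+1 k).
  rewrite /= !natrM => e.
  have -> : 'C(n.+1, k.+1)%:R =
      k.+1%:R^-1 * ((n.+1 - k)%:R * 'C(n.+1, k)%:R) :> R.
    by rewrite -e mulKf// pnatr_eq0.
  by rewrite exprS invfM; ring.
have -> : k.+1`!%:R^-1 = k`!%:R^-1 * (1 * k.+1%:R^-1) :> R.
  by rewrite factS natrM invfM mul1r mulrC.
apply: cvgM => //; apply: cvgM; last exact: cvg_cst.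
have : 1 - k%:R * n.+1%:R^-1 @[n --> \oo] --> (1 - k%:R * 0 : R).
  apply: cvgB; first exact: cvg_cst.
  by apply: cvgM; [exact: cvg_cst|exact: cvg_harmonic].
rewrite mulr0 subr0; apply: cvg_trans; apply: near_eq_cvg.
near=> n.
have kn : (k <= n.+1)%N by apply: leqW; near: n; exact: nbhs_infty_ge.
by rewrite natrB// mulrBl divff// pnatr_eq0.
Unshelve. all: by end_near. Qed.

End BinomialCoefficients.

(** * Endomorphisms as a Banach algebra *)

Section LfunTopology.
Variables (R : realType) (U V : vectType R).

Local Notation mx := (mxof (vbasis {:U}) (vbasis {:V})).
Local Notation hom := (hommx (vbasis {:U}) (vbasis {:V})).

Lemma lfun_normE (A : 'Hom(U, V)) : `|A| = `|mx A|.
Proof. by []. Qed.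

(** The matrix representation is an isometry by definition of the norm, so that
convergence may be tested on matrices. *)
Lemma cvg_mxof T (F : set_system T) {FF : Filter F} (u : T -> 'Hom(U, V))
    (l : 'Hom(U, V)) :
  (mx (u x) @[x --> F] --> mx l) -> u x @[x --> F] --> l.
Proof.
move=> ul; apply/cvgrPdist_le => e e0; move/cvgrPdist_le: ul => /(_ e e0).
by apply: filterS => x; rewrite lfun_normE linearB.
Qed.

(** Completeness is transported from matrices; it is what makes the exponential
series converge. *)
Lemma lfun_complete (F : set_system 'Hom(U, V)) :
  ProperFilter F -> cauchy F -> cvg F.
Proof.
move=> FF /cauchyP Fc; apply/cvg_ex.
have mFc : cauchy (mx @ F).
  apply/cauchyP => e e0; have [A FA] := Fc e e0.
  exists (mx A); have : F (mx @^-1` ball (mx A) e); last by [].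
  apply: filterS FA => B; rewrite -!ball_normE /ball_ /=.
  by rewrite -linearB.
have [M mFM] : exists M : 'M[R]_(\dim {:U}, \dim {:V}),
    mx @ F --> M.
  by exists (lim (mx @ F)); exact: mx_complete.
exists (hom M); have -> : F = id @ F by apply/funext => A; apply/propext.
by apply: cvg_mxof; rewrite hommxK ?vbasisP.
Qed.

HB.instance Definition _ := Uniform_isComplete.Build 'Hom(U, V) lfun_complete.

End LfunTopology.

(** The sup norm is submultiplicative only up to the inner dimension, hence the
factor [\dim] in all later estimates. *)
Lemma mulmx_norm_le (R : realType) (m n p : nat) (A : 'M[R]_(m, n))
    (B : 'M[R]_(n, p)) :
  `|A *m B| <= n%:R * `|A| * `|B|.
Proof.
have le_norm a b (M : 'M[R]_(a, b)) i j : `|M i j| <= `|M|.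
  by rewrite -[leRHS]/(mx_norm M) mx_normrE; exact: (le_bigmax _ _ (i, j)).
rewrite -[leLHS]/(mx_norm (A *m B)) mx_normrE; apply/bigmax_leP; split.
  by rewrite !mulr_ge0.
move=> [i j] _ /=; rewrite mxE (le_trans (ler_norm_sum _ _ _))//.
have -> : n%:R * `|A| * `|B| = \sum_(k < n) `|A| * `|B|.
  by rewrite sumr_const card_ord -mulrA mulr_natl.
apply: ler_sum => k _.
by rewrite normrM ler_pM.
Qed.

Section LfunNormComp.
Variables (R : realType) (U V W : vectType R).

Lemma lfun_norm_comp (A : 'Hom(V, W)) (B : 'Hom(U, V)) :
  `|(A \o B)%VF| <= (\dim {:V})%:R * `|A| * `|B|.
Proof.
rewrite !lfun_normE (mxof_comp _ _ (vbasisP {:V})).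
by rewrite (le_trans (mulmx_norm_le _ _))// mulrAC.
Qed.

Lemma cvg_comp_lfun T (F : set_system T) {FF : Filter F}
    (u : T -> 'Hom(V, W)) (v : T -> 'Hom(U, V)) A B :
  u x @[x --> F] --> A -> v x @[x --> F] --> B ->
  (u x \o v x)%VF @[x --> F] --> (A \o B)%VF.
Proof.
move=> uA vB; set d : R := (\dim {:V})%:R.
have uA0 : `|A - u x| @[x --> F] --> (0 : R).
  rewrite -(normr0 'Hom(V, W)) -(subrr A).
  by apply: cvg_norm; apply: cvgB => //; exact: cvg_cst.
have vB0 : `|B - v x| @[x --> F] --> (0 : R).
  rewrite -(normr0 'Hom(U, V)) -(subrr B).
  by apply: cvg_norm; apply: cvgB => //; exact: cvg_cst.
apply/cvgrPdist_le => e e0.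
have : d * `|A - u x| * `|v x| + d * `|A| * `|B - v x| @[x --> F]
    --> d * 0 * `|B| + d * `|A| * (0 : R).
  apply: cvgD; apply: cvgM => //; try exact: cvg_cst.
    by apply: cvgM => //; exact: cvg_cst.
  exact: cvg_norm.
rewrite !mulr0 mul0r addr0 => /cvgrPdist_le/(_ e e0); apply: filterS => x.
rewrite sub0r normrN; apply: le_trans; rewrite ger0_norm; last first.
  by rewrite addr_ge0// !mulr_ge0.
have -> : (A \o B)%VF - (u x \o v x)%VF =
    ((A - u x) \o v x)%VF + (A \o (B - v x))%VF.
  by rewrite comp_lfunDl comp_lfunDr comp_lfunNl comp_lfunNr [RHS]addrC subrKA.
by rewrite (le_trans (ler_normD _ _))// lerD// lfun_norm_comp.
Qed.

End LfunNormComp.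

(** * The exponential as a limit of powers *)

Section LfunExp.
Variables (R : realType) (V : vectType R).
Implicit Types A B X : 'End(V).
Local Notation d := ((\dim {:V})%:R : R).
Local Notation mx := (mxof (vbasis {:V}) (vbasis {:V})).

Lemma lfun_norm1_le : `|\1%VF : 'End(V)| <= 1.
Proof.
rewrite lfun_normE mxof1 ?(basis_free (vbasisP _))//.
rewrite -[leLHS]/(mx_norm 1%:M) mx_normrE.
apply/bigmax_leP; split=> // -[i j] _ /=.
by rewrite mxE; case: eqP; rewrite ?normr1 ?normr0.
Qed.

Lemma lfun_powS A k : lfun_pow A k.+1 = (A \o lfun_pow A k)%VF.
Proof. by []. Qed.

Lemma lfun_pow_norm A k : `|lfun_pow A k| <= (d * `|A|) ^+ k.
Proof.
elim: k => [|k IH]; first exact: lfun_norm1_le.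
rewrite exprS (le_trans (lfun_norm_comp _ _))// ler_wpM2l// mulr_ge0//.
Qed.

Lemma mxof_pow A k : mx (lfun_pow A k) = mx A ^+ k.
Proof.
elim: k => [|k IH]; first by rewrite mxof1// (basis_free (vbasisP _)).
by rewrite exprSr -IH lfun_powS (mxof_comp _ _ (vbasisP {:V})).
Qed.

Lemma lfun_pow_add1 A n :
  lfun_pow (\1%VF + A) n = \sum_(0 <= k < n.+1) 'C(n, k)%:R *: lfun_pow A k.
Proof.
apply: (can_inj (mxofK (vbasisP {:V}) (vbasisP {:V}))).
rewrite mxof_pow addrC linearD /= mxof1 ?(basis_free (vbasisP _))//.
rewrite exprD1n linear_sum big_mkord; apply: eq_bigr => i _.
by rewrite linearZ /= mxof_pow scaler_nat.
Qed.

Lemma lfun_powZ A (t : R) k : lfun_pow (t *: A) k = t ^+ k *: lfun_pow A k.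
Proof.
elim: k => [|k IH]; first by rewrite expr0 scale1r.
rewrite !lfun_powS IH.
by rewrite -comp_lfunZl -comp_lfunZr scalerA -exprS.
Qed.

Lemma cvg_lfun_pow T (F : set_system T) {FF : Filter F} (u : T -> 'End(V)) A k :
  u x @[x --> F] --> A -> lfun_pow (u x) k @[x --> F] --> lfun_pow A k.
Proof.
move=> uA; elim: k => [|k IH]; first exact: cvg_cst.
exact: cvg_comp_lfun.
Qed.

(** The binomial expansion of the power on the left has the coefficients
['C(n.+1, k) / n.+1 ^ k], bounded by and converging to [1 / k!], so [tannery]
applies with an exponential series as dominating series. That [B n] may depend
on [n] is essential: it is what lets the limit be computed along an arbitrary
curve through the identity. Convergence of the exponential series is obtained
at the same time. *)
Lemma cvg_lfun_exp_euler (B : nat -> 'End(V)) A :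
  B n @[n --> \oo] --> A ->
  cvgn (series (fun k => k`!%:R^-1 *: lfun_pow A k)) /\
  lfun_pow (\1%VF + n.+1%:R^-1 *: B n) n.+1 @[n --> \oo] --> lfun_exp A.
Proof.
move=> BA.
pose f n k := ('C(n.+1, k)%:R / n.+1%:R ^+ k) *: lfun_pow (B n) k.
pose c := d * (`|A| + 1).
have -> : (fun n => lfun_pow (\1%VF + n.+1%:R^-1 *: B n) n.+1) =
    (fun n => series (f n) n.+2).
  apply/funext => n; rewrite lfun_pow_add1; apply: eq_bigr => k _.
  by rewrite lfun_powZ scalerA exprVn.
apply: (@tannery _ _ _ _ (exp_coeff c)).
- by move=> n; rewrite ltnW.
- exact: is_cvg_series_exp_coeff.
- have : \forall n \near \oo, `|B n| <= `|A| + 1.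
    move/cvgrPdist_le: BA => /(_ 1 ltr01); apply: filterS => n AB.
    by rewrite -[B n](subrK A) (le_trans (ler_normD _ _))// addrC distrC lerD2l.
  apply: filterS => n Bn k; rewrite normrZ /exp_coeff /= mulrC ger0_norm//.
  rewrite ler_pM// ?bin_expn_le// (le_trans (lfun_pow_norm _ _))//.
  by rewrite lerXn2r ?nnegrE ?ler_wpM2l ?mulr_ge0 ?addr_ge0.
- move=> k; apply: cvgZ; first exact: cvg_bin_expn.
  exact: cvg_lfun_pow.
Qed.

End LfunExp.

(** * Curves through the identity *)

Section Tangent.
Variables (R : realType) (V : vectType R).
Implicit Types A B X : 'End(V).
Local Notation d := ((\dim {:V})%:R : R).

Lemma is_cvg_lfun_exp A :
  series (fun k => k`!%:R^-1 *: lfun_pow A k) @ \oo --> lfun_exp A.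
Proof. by case: (cvg_lfun_exp_euler (cvg_cst A)). Qed.

(** The terms of the series from rank 2 on are bounded by those of
[c ^ 2 * expR c], where [c] is the norm up to the dimension factor, since
[1 / (k + 2)! <= 1 / k!]. *)
Lemma lfun_exp_sub1_le X :
  `|lfun_exp X - (\1%VF + X)| <= (d * `|X|) ^+ 2 * expR (d * `|X|).
Proof.
set c := d * `|X|; have c0 : 0 <= c by rewrite mulr_ge0.
set u := fun k => k`!%:R^-1 *: lfun_pow X k.
have ul : `|series u n - (\1%VF + X)| @[n --> \oo]
    --> `|lfun_exp X - (\1%VF + X)|.
  by apply: cvg_norm; apply: cvgB; [exact: is_cvg_lfun_exp|exact: cvg_cst].
rewrite -(cvg_lim (@norm_hausdorff _ _) ul); apply: limr_le.
  by apply/cvg_ex; eexists; exact: ul.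
exists 2%N => // -[|[|n]]//= _.
have -> : \1%VF + X = series u 2.
  rewrite !seriesSr /series /= big_geq// add0r /u fact0 invr1.
  by rewrite !scale1r lfun_powS comp_lfun1r.
rewrite sub_series_geq// !big_add1 /=.
have le_exp : series (exp_coeff c) n <= expR c.
  apply: nondecreasing_cvgn_le; last exact: is_cvg_series_exp_coeff.
  by apply: nondecreasing_series => k _ _; exact: exp_coeff_ge0.
apply: le_trans (ler_wpM2l (sqr_ge0 c) le_exp).
rewrite /series /= mulr_sumr (le_trans (ler_norm_sum _ _ _))//.
apply: ler_sum => k _; rewrite normrZ /exp_coeff /= mulrA -exprD add2n.
rewrite mulrC ler_pM//; first exact: (lfun_pow_norm X k.+2).
rewrite ger0_norm// lef_pV2 ?posrE ?ltr0n ?fact_gt0//.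
by rewrite ler_nat leq_fact// leqW.
Qed.

(** The curve [c] has the velocity [A] at the identity, a condition on the
values [c h] with [h != 0] only. *)
Definition tangent (c : R -> 'End(V)) A : Prop :=
  h^-1 *: (c h - \1%VF) @[h --> 0^'] --> A.

Lemma cvg_id_dnbhs0 : h @[h --> (0 : R)^'] --> (0 : R).
Proof. exact: cvg_within. Qed.

Lemma tangent_unique c A B : tangent c A -> tangent c B -> A = B.
Proof. exact: cvg_unique. Qed.

Lemma near_eq_tangent c c' A :
  (\forall h \near 0^', c h = c' h) -> tangent c A -> tangent c' A.
Proof.
move=> cc'; apply: cvg_trans; apply: near_eq_cvg.
by apply: filterS cc' => h /= ->.
Qed.

Lemma tangent_line A : tangent (fun h => \1%VF + h *: A) A.
Proof.
have : (A : 'End(V)) @[h --> (0 : R)^'] --> A by exact: cvg_cst.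
apply: cvg_trans; apply: near_eq_cvg.
near=> h; rewrite addrAC subrr add0r scalerA mulVf ?scale1r//.
by near: h; exact: nbhs_dnbhs_neq.
Unshelve. all: by end_near. Qed.

Arguments tangent_line A : clear implicits.

Lemma tangent_exp A : tangent (fun h => lfun_exp (h *: A)) A.
Proof.
apply/cvgrPdist_le => e e0.
pose K := (d * `|A|) ^+ 2 * expR (d * `|A|).
have h1 : `|h| @[h --> (0 : R)^'] --> (0 : R).
  rewrite -[X in _ --> X](normr0 R); apply: cvg_norm; exact: cvg_id_dnbhs0.
have hK : `|h| * K @[h --> (0 : R)^'] --> (0 : R).
  by rewrite -[X in _ --> X](mul0r K); apply: cvgM => //; exact: cvg_cst.
near=> h.
have h0 : h != 0 by near: h; exact: nbhs_dnbhs_neq.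
have hle1 : `|h| <= 1.
  near: h; have /cvgrPdist_le/(_ 1 ltr01) := h1.
  by apply: filterS => h; rewrite sub0r normrN normr_id.
have hKe : `|h| * K <= e.
  near: h; have /cvgrPdist_le/(_ e e0) := hK.
  by apply: filterS => h; rewrite sub0r normrN; apply: le_trans (ler_norm _).
apply: le_trans hKe.
have -> : A - h^-1 *: (lfun_exp (h *: A) - \1%VF)
    = - (h^-1 *: (lfun_exp (h *: A) - (\1%VF + h *: A))).
  by rewrite opprD addrA [X in _ = - X]scalerBr scalerA mulVf// scale1r opprB.
rewrite normrN normrZ normfV ler_pdivrMl ?normr_gt0//.
apply: le_trans (lfun_exp_sub1_le _) _.
rewrite normrZ mulrCA /K; set c := d * _.
have -> : `|h| * (`|h| * (c ^+ 2 * expR c)) = (`|h| * c) ^+ 2 * expR c by ring.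
rewrite ler_wpM2l ?sqr_ge0//.
by rewrite ler_expR ler_piMl// mulr_ge0.
Unshelve. all: by end_near. Qed.

Arguments tangent_exp A : clear implicits.

(** The value of [c] at 0 matters when [t = 0], where the rescaled curve is
constant. *)
Lemma tangent_scale c A t : c 0 = \1%VF -> tangent c A ->
  tangent (fun h => c (t * h)) (t *: A).
Proof.
move=> c0 cA; have [->|t0] := eqVneq t 0.
  rewrite scale0r; have := tangent_line 0; apply: near_eq_tangent.
  by apply: nearW => h; rewrite scaler0 addr0 mul0r c0.
have th0 : t * h @[h --> (0 : R)^'] --> (0 : R)^'.
  move=> P P0; suff : \forall h \near 0^', P (t * h) by [].
  have th : t * h @[h --> (0 : R)^'] --> (0 : R).
    rewrite -[X in _ --> X](mulr0 t); apply: cvgM; first exact: cvg_cst.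
    exact: cvg_id_dnbhs0.
  near=> h.
  have h0 : h != 0 by near: h; exact: nbhs_dnbhs_neq.
  suff : t * h != 0 by near: h; exact: th P0.
  by rewrite mulf_neq0.
have : t *: ((t * h)^-1 *: (c (t * h) - \1%VF)) @[h --> 0^'] --> t *: A.
  apply: cvgZ; first exact: cvg_cst.
  exact: (cvg_comp (fun h => t * h) (fun h => h^-1 *: (c h - \1%VF)) th0 cA).
apply: cvg_trans; apply: near_eq_cvg; apply: nearW => h /=.
by rewrite scalerA invfM mulrA divff// mul1r.
Unshelve. all: by end_near. Qed.

Lemma cvg_tangent c A : tangent c A -> c h @[h --> 0^'] --> (\1%VF : 'End(V)).
Proof.
move=> cA.
have : \1%VF + h *: (h^-1 *: (c h - \1%VF)) @[h --> 0^'] --> \1%VF + 0 *: A.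
  apply: cvgD; first exact: cvg_cst.
  by apply: cvgZ => //; exact: cvg_id_dnbhs0.
rewrite scale0r addr0; apply: cvg_trans; apply: near_eq_cvg; near=> h.
rewrite scalerA divff ?scale1r ?subrKC//.
by near: h; exact: nbhs_dnbhs_neq.
Unshelve. all: by end_near. Qed.

(** Leibniz rule at the identity:
[c h \o c' h - 1 = (c h - 1) \o c' h + (c' h - 1)]. *)
Lemma tangent_comp c c' A B : tangent c A -> tangent c' B ->
  tangent (fun h => (c h \o c' h)%VF) (A + B).
Proof.
move=> cA cB.
have : ((h^-1 *: (c h - \1%VF)) \o c' h)%VF + h^-1 *: (c' h - \1%VF)
    @[h --> 0^'] --> (A \o \1)%VF + B.
  by apply: cvgD => //; apply: cvg_comp_lfun => //; exact: cvg_tangent cB.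
rewrite comp_lfun1r; apply: cvg_trans; apply: near_eq_cvg; near=> h.
by rewrite -comp_lfunZl -scalerDr comp_lfunDl comp_lfunNl comp_lfun1l subrKA.
Unshelve. all: by end_near. Qed.

Lemma cvg_invS_dnbhs0 : n.+1%:R^-1 @[n --> \oo] --> (0 : R)^'.
Proof.
move=> P P0; suff : \forall n \near \oo, P n.+1%:R^-1 by [].
have P0' : nbhs (0 : R) [set x | x != 0 -> P x] by exact: P0.
have : \forall n \near \oo, [set x | x != 0 -> P x] (n.+1%:R^-1 : R).
  exact: (@cvg_harmonic R _ P0').
by apply: filterS => n; apply; rewrite invr_eq0 pnatr_eq0.
Qed.

(** The curve at [1 / n.+1] is [1 + B n / n.+1] with [B n] its difference
quotient, which tends to [A]. *)
Lemma tangent_euler c A : tangent c A ->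
  lfun_pow (c n.+1%:R^-1) n.+1 @[n --> \oo] --> lfun_exp A.
Proof.
move=> cA.
have := cvg_comp (fun n => n.+1%:R^-1) (fun h => h^-1 *: (c h - \1%VF))
  cvg_invS_dnbhs0 cA.
move=> /cvg_lfun_exp_euler[_].
apply: cvg_trans; apply: near_eq_cvg; apply: nearW => n /=.
by rewrite invrK scalerA mulVf ?pnatr_eq0// scale1r subrKC.
Qed.

End Tangent.
Arguments tangent_line {R V} A.
Arguments tangent_exp {R V} A.

(** * The general linear group *)

Section GeneralLinearGroup.
Variables (R : realType) (V : vectType R).
Implicit Types A B X : 'End(V).
Local Notation d := ((\dim {:V})%:R : R).

Lemma GL_left_inverse A B : (B \o A)%VF = \1%VF -> GL V A.
Proof.
move=> BA; apply/lker0P => u v Auv.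
by rewrite -[u]id_lfunE -[v]id_lfunE -BA !comp_lfunE Auv.
Qed.

Lemma GL1 : GL V \1%VF.
Proof. by apply: (@GL_left_inverse _ \1%VF); rewrite comp_lfun1l. Qed.

Lemma GL_comp A B : GL V A -> GL V B -> GL V (A \o B)%VF.
Proof.
move=> GA GB; apply: (@GL_left_inverse _ (B^-1 \o A^-1)%VF).
by rewrite comp_lfunA -(comp_lfunA _ (A^-1)%VF) lker0_compVf// comp_lfun1r
  lker0_compVf.
Qed.

Lemma GL_pow A n : GL V A -> GL V (lfun_pow A n).
Proof.
by move=> GA; elim: n => [|n IH]; [exact: GL1|exact: GL_comp].
Qed.

(** If [K] is a projection onto the kernel of [1 + A], then [K = - A \o K], so
that the norm of [K] is at most a proper fraction of itself and [K = 0]. *)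
Lemma GL_near1 A : d * `|A| < 1 -> GL V (\1%VF + A).
Proof.
move=> A1; set K := projv (lker (\1%VF + A)).
have K0 : K = 0.
  have : ((\1%VF + A) \o K)%VF = 0.
    apply/lfunP => v; rewrite comp_lfunE zero_lfunE; apply/eqP.
    by rewrite -memv_ker memv_proj.
  rewrite comp_lfunDl comp_lfun1l => /eqP; rewrite addr_eq0 => /eqP KA.
  apply/eqP; rewrite -normr_eq0 -[_ == 0]negbK; apply/negP => nK.
  have : `|K| <= d * `|A| * `|K|.
    by rewrite {1}KA normrN lfun_norm_comp.
  have K_gt0 : 0 < `|K| by rewrite lt0r nK /=.
  by rewrite leNgt gtr_pMl// A1.
apply/eqP/vspaceP => v; apply/idP/idP => [vK|]; last first.
  by rewrite memv0 => /eqP ->; rewrite mem0v.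
by rewrite -(projv_id vK) -/K K0 zero_lfunE mem0v.
Qed.

Lemma GL_near_tangent (c : R -> 'End(V)) A :
  tangent c A -> \forall h \near 0^', GL V (c h).
Proof.
move=> /cvg_tangent c1.
have : d * `|c h - \1%VF| @[h --> (0 : R)^'] --> d * `|\1%VF - \1%VF : 'End(V)|.
  apply: cvgM; first exact: cvg_cst.
  by apply: cvg_norm; apply: cvgB => //; exact: cvg_cst.
rewrite subrr normr0 mulr0 => /cvgrPdist_lt/(_ 1 ltr01).
apply: filterS => h; rewrite sub0r normrN => dc.
rewrite -[c h](subrKC \1%VF); apply: GL_near1.
by apply: le_lt_trans (ler_norm _) _.
Qed.

Lemma lfun_pow_comp A B n : (A \o B = B \o A)%VF ->
  lfun_pow (A \o B)%VF n = (lfun_pow A n \o lfun_pow B n)%VF.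
Proof.
move=> AB.
have ABn m : (lfun_pow A m \o B = B \o lfun_pow A m)%VF.
  elim: m => [|m IH]; first by rewrite comp_lfun1l comp_lfun1r.
  by rewrite !lfun_powS -comp_lfunA IH !comp_lfunA AB.
elim: n => [|n IH]; first by rewrite comp_lfun1l.
by rewrite !lfun_powS IH -!comp_lfunA; congr comp_lfun; rewrite !comp_lfunA ABn.
Qed.

Lemma lfun_exp0 : lfun_exp 0 = \1%VF :> 'End(V).
Proof.
have /tangent_euler : tangent (fun=> \1%VF : 'End(V)) 0.
  by have := tangent_line (0 : 'End(V)); apply: near_eq_tangent;
    apply: nearW => h; rewrite scaler0 addr0.
have -> : (fun n => lfun_pow \1%VF n.+1) = (fun=> \1%VF : 'End(V)).
  apply/funext => n; elim: n => [|n IH]; first by rewrite lfun_powS comp_lfun1l.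
  by rewrite lfun_powS IH comp_lfun1l.
by move=> e1; apply: (cvg_unique (@norm_hausdorff _ _) e1); exact: cvg_cst.
Qed.

(** For each [n] the powers approximating both factors multiply to the power
of the curve [(1 - h A) \o (1 + h A)], which is tangent to 0. *)
Lemma lfun_expN A : (lfun_exp (- A) \o lfun_exp A)%VF = \1%VF.
Proof.
have tA := tangent_line A; have tNA := tangent_line (- A).
have e0 := tangent_euler (tangent_comp tNA tA).
rewrite -lfun_exp0 -(addNr A); apply/esym.
apply: (cvg_unique (@norm_hausdorff _ _) e0).
pose c n B : 'End(V) := \1%VF + n.+1%:R^-1 *: B.
have : (lfun_pow (c n (- A)) n.+1 \o lfun_pow (c n A) n.+1)%VF @[n --> \oo]
    --> (lfun_exp (- A) \o lfun_exp A)%VF.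
  apply: cvg_comp_lfun; [exact: tangent_euler tNA|exact: tangent_euler tA].
apply: cvg_trans; apply: near_eq_cvg; apply: nearW => n.
have cC : (c n (- A) \o c n A = c n A \o c n (- A))%VF.
  rewrite /c scalerN; set X := _ *: A; rewrite !comp_lfunDl !comp_lfunDr.
  rewrite !comp_lfun1l !comp_lfunNl !comp_lfunNr !comp_lfun1r.
  by rewrite !addrA addrK subrK.
by rewrite -(lfun_pow_comp _ cC).
Qed.

Lemma GL_exp A : GL V (lfun_exp A).
Proof. exact: GL_left_inverse (lfun_expN A). Qed.

End GeneralLinearGroup.

(** * The differential of a homomorphism of general linear groups *)

Section LieGroupHom.
Variables (R : realType) (V1 V2 : vectType R) (Phi : 'End(V1) -> 'End(V2)).
Hypothesis PhiP : lie_group_hom Phi.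
Implicit Types A B C P Z : 'End(V1).

Lemma lie_hom_GL A : GL V1 A -> GL V2 (Phi A).
Proof. by case: PhiP => + _ _; apply. Qed.

Lemma lie_hom_comp A B : GL V1 A -> GL V1 B ->
  Phi (A \o B)%VF = (Phi A \o Phi B)%VF.
Proof. by case: PhiP => _ + _; apply. Qed.

Lemma lie_hom1 : Phi \1%VF = \1%VF.
Proof.
have G1 := @GL1 R V1; have PG1 := lie_hom_GL G1.
rewrite -[LHS](lker0_compKf PG1) -lie_hom_comp// comp_lfun1l.
by rewrite lker0_compVf.
Qed.

Lemma lie_hom_pow A n : GL V1 A -> Phi (lfun_pow A n) = lfun_pow (Phi A) n.
Proof.
move=> GA; elim: n => [|n IH]; first exact: lie_hom1.
by rewrite !lfun_powS -IH lie_hom_comp//; exact: GL_pow.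
Qed.

Lemma lie_hom_continuous A : GL V1 A -> {for A, continuous Phi}.
Proof. by case: PhiP => _ _ /(_ 0%N)[+ _]; apply. Qed.

(** The directional derivative of [Phi] at the identity; its additivity in [A]
is a theorem ([lie_diffD]), since [Phi] is differentiated along lines only. *)
Definition lie_diff A : 'End(V2) := 'D_A Phi \1%VF.

Lemma tangent_lie_diff A :
  tangent (fun h => Phi (\1%VF + h *: A)) (lie_diff A).
Proof.
have : derivable Phi \1%VF A.
  by case: PhiP => _ _ /(_ 1%N)[_ /(_ A)[+ _]]; apply; exact: GL1.
rewrite /derivable /lie_diff /derive lie_hom1 /tangent => D.
under eq_fun do rewrite [\1%VF + _]addrC.
exact: D.
Qed.

Arguments tangent_lie_diff A : clear implicits.

(** Apply [Phi] to the powers [c (1/n) ^ n], which tend to [exp A]: their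
images are the powers of [Phi \o c], which tend to [exp B]. *)
Lemma lie_hom_exp_tangent (c : R -> 'End(V1)) A (B : 'End(V2)) :
  tangent c A -> tangent (Phi \o c) B -> Phi (lfun_exp A) = lfun_exp B.
Proof.
move=> cA PB; apply/esym/(cvg_unique (@norm_hausdorff _ _) (tangent_euler PB)).
have : Phi (lfun_pow (c n.+1%:R^-1) n.+1) @[n --> \oo] --> Phi (lfun_exp A).
  by apply: continuous_cvg (tangent_euler cA); exact/lie_hom_continuous/GL_exp.
apply: cvg_trans; apply: near_eq_cvg.
have : \forall n \near \oo, GL V1 (c n.+1%:R^-1).
  exact: cvg_invS_dnbhs0 (GL_near_tangent cA).
by apply: filterS => n Gn; rewrite lie_hom_pow.
Qed.

Lemma lie_hom_exp A : Phi (lfun_exp A) = lfun_exp (lie_diff A).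
Proof.
exact: (@lie_hom_exp_tangent (fun h => \1%VF + h *: A) A _
  (tangent_line A) (tangent_lie_diff A)).
Qed.

(** The chain rule for the curve [c], derived from the group structure: the
curves [1 + t h A] and [c (t h)] are both tangent to [t A], so
[lie_hom_exp_tangent] computes [Phi (exp (t A))] in two ways, and the two
resulting one-parameter groups have the same derivative at [t = 0]. *)
Lemma lie_diff_tangent (c : R -> 'End(V1)) A (B : 'End(V2)) : c 0 = \1%VF ->
  tangent c A -> tangent (Phi \o c) B -> lie_diff A = B.
Proof.
move=> c0 cA PB.
have expP t : lfun_exp (t *: lie_diff A) = lfun_exp (t *: B).
  rewrite -(@lie_hom_exp_tangent (fun h => c (t * h)) (t *: A) (t *: B)).
  - apply/esym/(@lie_hom_exp_tangent (fun h => \1%VF + (t * h) *: A)).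
      apply: (tangent_scale _ (tangent_line A)).
      by rewrite scale0r addr0.
    apply: (tangent_scale _ (tangent_lie_diff A)).
    by rewrite scale0r addr0 lie_hom1.
  - exact: tangent_scale.
  - by apply: (tangent_scale _ PB); rewrite /= c0 lie_hom1.
apply: tangent_unique (tangent_exp (lie_diff A)) _.
by under eq_fun do rewrite expP; exact: tangent_exp.
Qed.

Lemma lie_diffZ t A : lie_diff (t *: A) = t *: lie_diff A.
Proof.
have c0 : \1%VF + (0 : R) *: A = \1%VF by rewrite scale0r addr0.
apply: (@lie_diff_tangent (fun h => \1%VF + (t * h) *: A)).
- by rewrite mulr0.
- exact: (tangent_scale _ (tangent_line A)).
- by apply: (tangent_scale _ (tangent_lie_diff A)); rewrite c0 lie_hom1.
Qed.

Lemma lie_diffD A B : lie_diff (A + B) = lie_diff A + lie_diff B.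
Proof.
pose c h := ((\1%VF + h *: A) \o (\1%VF + h *: B))%VF.
apply: (@lie_diff_tangent c).
- by rewrite /c !scale0r !addr0 comp_lfun1l.
- exact: tangent_comp (tangent_line A) (tangent_line B).
apply: near_eq_tangent (tangent_comp (tangent_lie_diff A) (tangent_lie_diff B)).
near=> h; rewrite /= /c lie_hom_comp//; near: h;
  exact: GL_near_tangent (tangent_line _).
Unshelve. all: by end_near. Qed.

Lemma lie_diff_linear : linear lie_diff.
Proof. by move=> t A B; rewrite lie_diffD lie_diffZ. Qed.

(** Differentiate
[Phi (1 + h (P \o Z)) \o Phi P = Phi P \o Phi (1 + h (Z \o P))] at [h = 0].
This is the compatibility with conjugation by [P], in a form in which the
inverse of [P] does not occur. *)
Lemma lie_diff_conj P Z : GL V1 P ->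
  (lie_diff (P \o Z) \o Phi P = Phi P \o lie_diff (Z \o P))%VF.
Proof.
move=> GP.
pose q Y h : 'End(V2) := h^-1 *: (Phi (\1%VF + h *: Y) - \1%VF).
have qP Y : q Y h @[h --> 0^'] --> lie_diff Y by exact: tangent_lie_diff.
have e0 : (q (P \o Z)%VF h \o Phi P)%VF @[h --> 0^']
    --> (lie_diff (P \o Z) \o Phi P)%VF.
  by apply: cvg_comp_lfun; [exact: qP|exact: cvg_cst].
apply: (cvg_unique (@norm_hausdorff _ _) e0).
have : (Phi P \o q (Z \o P)%VF h)%VF @[h --> 0^']
    --> (Phi P \o lie_diff (Z \o P))%VF.
  by apply: cvg_comp_lfun; [exact: cvg_cst|exact: qP].
apply: cvg_trans; apply: near_eq_cvg; near=> h.
have G1 : GL V1 (\1%VF + h *: (P \o Z)%VF).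
  by near: h; exact: GL_near_tangent (tangent_line _).
have G2 : GL V1 (\1%VF + h *: (Z \o P)%VF).
  by near: h; exact: GL_near_tangent (tangent_line _).
rewrite /q -comp_lfunZr -comp_lfunZl !(comp_lfunDl, comp_lfunDr).
rewrite comp_lfunNl comp_lfunNr comp_lfun1l comp_lfun1r -!lie_hom_comp//.
rewrite comp_lfunDl comp_lfunDr comp_lfun1l comp_lfun1r.
by rewrite -comp_lfunZr -comp_lfunZl comp_lfunA.
Unshelve. all: by end_near. Qed.

(** Take [P h = 1 + h A] in [lie_diff_conj] and expand by linearity: the terms
of order 0 in [h] assemble to a commutator of [lie_diff C] with [Phi (P h)],
and dividing by [h] leaves the commutator with the difference quotient of
[Phi] on one side ([PC]). Both sides have limits as [h] tends to 0. *)
Lemma lie_diff_bracket A C :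
  lie_diff ((A \o C)%VF - (C \o A)%VF) =
  (lie_diff A \o lie_diff C)%VF - (lie_diff C \o lie_diff A)%VF.
Proof.
pose P h := \1%VF + h *: A.
pose q h := h^-1 *: (Phi (P h) - \1%VF).
have qA : q h @[h --> 0^'] --> lie_diff A by exact: tangent_lie_diff.
have PA : Phi (P h) @[h --> 0^'] --> \1%VF.
  exact: cvg_tangent (tangent_lie_diff A).
have PC h : GL V1 (P h) -> h != 0 ->
    (q h \o lie_diff C)%VF - (lie_diff C \o q h)%VF =
    (lie_diff (A \o C) \o Phi (P h))%VF - (Phi (P h) \o lie_diff (C \o A))%VF.
  move=> GP h0; have := lie_diff_conj C GP.
  have -> : lie_diff (P h \o C)%VF = lie_diff C + h *: lie_diff (A \o C)%VF.
    by rewrite /P comp_lfunDl comp_lfun1l -comp_lfunZl lie_diffD lie_diffZ.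
  have -> : lie_diff (C \o P h)%VF = lie_diff C + h *: lie_diff (C \o A)%VF.
    by rewrite /P comp_lfunDr comp_lfun1r -comp_lfunZr lie_diffD lie_diffZ.
  rewrite comp_lfunDl comp_lfunDr -comp_lfunZl -comp_lfunZr.
  move=> /(congr1 (fun X => h^-1 *: X)); rewrite !scalerDr !scalerA mulVf//.
  rewrite !scale1r /q => e.
  rewrite -comp_lfunZl -comp_lfunZr -scalerBr comp_lfunDl comp_lfunDr.
  rewrite comp_lfunNl comp_lfunNr comp_lfun1l comp_lfun1r.
  rewrite opprB addrA subrK scalerBr.
  by apply/eqP; rewrite subr_eq addrAC eq_sym subr_eq addrC e.
rewrite -scaleN1r lie_diffD lie_diffZ scaleN1r.
have e0 : (q h \o lie_diff C)%VF - (lie_diff C \o q h)%VF @[h --> 0^']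
    --> (lie_diff A \o lie_diff C)%VF - (lie_diff C \o lie_diff A)%VF.
  apply: cvgB; first by apply: cvg_comp_lfun; [exact: qA|exact: cvg_cst].
  by apply: cvg_comp_lfun; [exact: cvg_cst|exact: qA].
apply/esym/(cvg_unique (@norm_hausdorff _ _) e0).
have : (lie_diff (A \o C) \o Phi (P h))%VF
    - (Phi (P h) \o lie_diff (C \o A))%VF @[h --> 0^'] -->
    (lie_diff (A \o C) \o \1)%VF - (\1 \o lie_diff (C \o A))%VF.
  apply: cvgB; first by apply: cvg_comp_lfun; [exact: cvg_cst|exact: PA].
  by apply: cvg_comp_lfun; [exact: PA|exact: cvg_cst].
rewrite comp_lfun1l comp_lfun1r; apply: cvg_trans; apply: near_eq_cvg.
near=> h; rewrite /= PC//; near: h; last exact: nbhs_dnbhs_neq.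
exact: GL_near_tangent (tangent_line _).
Unshelve. all: by end_near. Qed.

End LieGroupHom.

(** * Hom-Lie group homomorphisms *)

Lemma is_derive_lfun_exp (R : realType) (V : vectType R) (A : 'End(V)) :
  is_derive (0 : R) (1 : R) (fun t : R => lfun_exp (t *: A)) A.
Proof.
have tA : h^-1 *: (((fun t : R => lfun_exp (t *: A)) \o shift (0 : R)) (h *: 1)
    - lfun_exp (0 *: A)) @[h --> 0^'] --> A.
  have := tangent_exp A; apply: cvg_trans; apply: near_eq_cvg.
  by apply: nearW => h; rewrite /= scale0r lfun_exp0 addr0 [h *: 1]mulr1.
apply: DeriveDef; first by apply/cvg_ex; exists A.
exact: (cvg_lim (@norm_hausdorff _ _) tA).
Qed.

Lemma lfun_invol_inv (R : realType) (V : vectType R) (g : 'End(V)) :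
  (g \o g)%VF = \1%VF -> (g^-1)%VF = g.
Proof.
move=> gg; have Gg : GL V g by exact: GL_left_inverse gg.
by rewrite -[LHS]comp_lfun1r -gg comp_lfunA lker0_compVf// comp_lfun1l.
Qed.

Theorem theorem4p13 (R : realType) (V : vectType R) (gamma beta : 'End(V))
  (gammaGL : GL V gamma) (betaGL : GL V beta)
  (neq_gamma_beta : gamma <> beta)
  (gamma_neq1 : gamma <> \1%VF) (beta_neq1 : beta <> \1%VF)
  (gamma_invol : (gamma \o gamma)%VF = \1%VF)
  (beta_invol : (beta \o beta)%VF = \1%VF)
  (Phi : 'End(V) -> 'End(V))
  (PhiP : hom_lie_group_hom (M_ gamma) (R_ gamma) (M_ beta) (R_ beta) Phi) :
  exists phi : {linear 'End(V) -> 'End(V)},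
    (forall X : 'End(V),
       Phi (lfun_exp (gamma \o X)%VF) = lfun_exp (beta \o phi X)%VF) /\
    [/\ (forall X : 'End(V), phi (Ad gamma X) = Ad beta (phi X)),
        (forall X Y : 'End(V),
           phi (lfun_exp (gamma \o X) \o gamma \o Y
                \o lfun_exp (- (gamma \o X)) \o gamma)%VF
           = (Phi (lfun_exp (gamma \o X) \o gamma) \o phi Y
              \o Phi (lfun_exp (- (gamma \o X)) \o gamma))%VF),
        (forall X Y : 'End(V),
           phi (hom_bracket gamma X Y) = hom_bracket beta (phi X) (phi Y))
      & (forall X : 'End(V),
           is_derive (0 : R) (1 : R)
             (fun t : R => Phi (lfun_exp (t *: (gamma \o X)%VF)))
             (beta \o phi X)%VF)].
Proof.
have [homPhi _ homF] := PhiP.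
have gammaM : M_ gamma gamma.
  by exists 0 => //; rewrite comp_lfun0r lfun_exp0 comp_lfun1l.
have Phi_gamma : Phi gamma = beta.
  have := homF _ _ gammaM gammaM.
  by rewrite gamma_invol /R_ !comp_lfun1l (lie_hom1 homPhi) comp_lfun1l => <-.
have ggK Z : (gamma \o (gamma \o Z) = Z)%VF.
  by rewrite comp_lfunA gamma_invol comp_lfun1l.
have bbK Z : (beta \o (beta \o Z) = Z)%VF.
  by rewrite comp_lfunA beta_invol comp_lfun1l.
pose D : 'End(V) -> 'End(V) := lie_diff Phi.
have D_gamma Z : (beta \o D (Z \o gamma) = D (gamma \o Z) \o beta)%VF.
  by rewrite -Phi_gamma; apply/esym/(lie_diff_conj homPhi).
have D_bracket A B : D ((A \o B)%VF - (B \o A)%VF)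
    = (D A \o D B)%VF - (D B \o D A)%VF.
  exact: (lie_diff_bracket homPhi).
pose phi_fun X := (beta \o D (gamma \o X))%VF.
have phi_linear : linear phi_fun.
  move=> t X Y; rewrite /phi_fun comp_lfunDr -comp_lfunZr.
  by rewrite [D _](lie_diff_linear homPhi) comp_lfunDr -comp_lfunZr.
pose phiL := GRing.isLinear.Build _ _ _ _ phi_fun phi_linear.
pose phi : {linear 'End(V) -> 'End(V)} := HB.pack phi_fun phiL.
have phiE X : phi X = (beta \o D (gamma \o X))%VF by [].
have beta_phi X : (beta \o phi X)%VF = D (gamma \o X)%VF by rewrite phiE bbK.
have phi_gamma Z : phi (Z \o gamma)%VF = (D Z \o beta)%VF.
  by rewrite phiE comp_lfunA D_gamma ggK.
exists phi; split=> [X|]; first by rewrite beta_phi (lie_hom_exp homPhi).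
have giE := lfun_invol_inv gamma_invol; have biE := lfun_invol_inv beta_invol.
split=> [X|X Y|X Y|X].
- by rewrite /Ad giE biE phi_gamma beta_phi.
(* Conjugation rule at [P = E], then [phi_gamma] absorbs the trailing
   [gamma]. *)
- set A := (gamma \o X)%VF; set E := lfun_exp A; set E' := lfun_exp (- A).
  have EE' : (E \o E')%VF = \1%VF.
    by have := lfun_expN (- A); rewrite opprK.
  have E'E : (E' \o E)%VF = \1%VF by exact: lfun_expN.
  have GE : GL V E by exact: GL_exp.
  have GE' : GL V E' by exact: GL_exp.
  rewrite phi_gamma !(lie_hom_comp homPhi)// Phi_gamma.
  have := lie_diff_conj homPhi (gamma \o Y \o E')%VF GE.
  rewrite -(comp_lfunA _ E') E'E comp_lfun1r => conjE.
  rewrite -[(Phi E \o beta \o phi Y)%VF]comp_lfunA beta_phi -conjE.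
  rewrite -!comp_lfunA [(Phi E \o (Phi E' \o beta))%VF]comp_lfunA.
  by rewrite -(lie_hom_comp homPhi)// EE' (lie_hom1 homPhi) comp_lfun1l.
- have bracket_gamma : hom_bracket gamma X Y =
      (((gamma \o X) \o (gamma \o Y))%VF -
        ((gamma \o Y) \o (gamma \o X))%VF \o gamma)%VF.
    by rewrite /hom_bracket giE comp_lfunDl comp_lfunNl !comp_lfunA.
  rewrite bracket_gamma phi_gamma D_bracket /hom_bracket biE.
  rewrite -!beta_phi comp_lfunDl comp_lfunNl.
  by rewrite (comp_lfunA _ beta (phi Y)) (comp_lfunA _ beta (phi X)).
- under eq_fun do rewrite (lie_hom_exp homPhi) (lie_diffZ homPhi).
  rewrite beta_phi; exact: is_derive_lfun_exp.
Qed.
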